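(* Let $H$ be a real Hilbert space, let $u_0\in H$, and let $F:H\to H$ be a twice Fréchet differentiable map such that $F'(u)$ is boundedly invertible for every $u\in H$. Assume that for every $R>0$ there are finite constants $M_1(R)$, $M_2(R)$ and $m(R)>0$ such that $$\sup_{u\in B(u_0,R)}\|F^{(j)}(u)\|\le M_j(R),\quad j=1,2,$$ and $$\sup_{u\in B(u_0,R)}\|[F'(u)]^{-1}\|\le m(R).$$ Then: (i) If $\sup_{R>0}\frac{R}{m(R)}=\infty$, then $F$ is surjective. (ii) If there are constants $a>0$ and $b>0$ such that $\|[F'(u)]^{-1}\|\le a\|u\|+b$ for all $u\in H$, then $F$ is a global homeomorphism of $H$ onto $H$.
   Context: $B(u_0,R)=\{u\in H:\|u-u_0\|\le R\}$ is the closed ball. $F^{(j)}(u)$ denotes the $j$-th Fréchet derivative of $F$ at $u$ (with $F'=F^{(1)}$), with its operator norm as a bounded linear ($j=1$) or bounded bilinear ($j=2$) map; $[F'(u)]^{-1}$ is the inverse of the bounded linear operator $F'(u):H\to H$. *)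

(* Defs.v *)
From HB Require Import structures.
From mathcomp Require Import all_boot all_order all_algebra sesquilinear.
From mathcomp Require Import all_classical all_reals all_analysis.

Set Implicit Arguments.
Unset Strict Implicit.
Unset Printing Implicit Defensive.

Import Order.TTheory GRing.Theory Num.Theory.
Import numFieldNormedType.Exports.

Local Open Scope classical_set_scope.
Local Open Scope ring_scope.

Section Operators.
Context {R : realType} {V W : normedModType R}.

(* Extended-real valued, so that boundedness of the (bi)linear map is not
   presupposed: the norm is +oo exactly when the map is unbounded. *)
Definition opnorm (L : V -> W) : \bar R :=
  ereal_sup [set `|L x|%:E | x in [set x : V | `|x| <= 1]].

Definition biopnorm (B : V -> V -> W) : \bar R :=
  ereal_sup [set `|B x.1 x.2|%:E
            | x in [set x : V * V | `|x.1| <= 1 /\ `|x.2| <= 1]].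

End Operators.

Section Inverse.
Context {R : realType} {V : normedModType R}.

Definition is_bounded_inverse (L : V -> V) (G : {linear V -> V}) : Prop :=
  [/\ (opnorm G < +oo)%E, cancel L G & cancel G L].

Definition boundedly_invertible (L : V -> V) : Prop :=
  exists G : {linear V -> V}, is_bounded_inverse L G.

(* Only meaningful when [boundedly_invertible L] holds; [get] then returns the
   unique [G] satisfying the specification. *)
Definition opinv (L : V -> V) : {linear V -> V} := get (is_bounded_inverse L).

End Inverse.

Section SecondDerivative.
Context {R : realType} {V W : normedModType R}.

(* [B] is the Frechet derivative at [u] of the map [x |-> 'd F x] into the
   space of bounded linear operators with the operator norm, where a bounded
   linear map [V -> L(V, W)] is identified with a bounded bilinear map:
     || 'd F (u + h) - 'd F u - B h || = o(||h||)   as h -> 0. *)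
Definition is_diff2 (F : V -> W) (u : V) (B : V -> V -> W) : Prop :=
  [/\ bilinear_for *:%R *:%R B,
      (biopnorm B < +oo)%E &
      forall e : R, 0 < e -> \forall h \near (0 : V),
        (opnorm (fun k => 'd F (u + h) k - 'd F u k - B h k)%R
          <= (e * `|h|)%:E)%E].

Definition twice_differentiable (F : V -> W) : Prop :=
  (forall u, differentiable F u) /\ (forall u, exists B, is_diff2 F u B).

Definition diff2 (F : V -> W) (u : V) : V -> V -> W := get (is_diff2 F u).

End SecondDerivative.

Definition homeomorphism (S T : topologicalType) (f : S -> T) : Prop :=
  exists g : T -> S, [/\ continuous f, continuous g, cancel f g & cancel g f].

(* Main.v *)
(* Both parts rest on damped Newton steps u + t F'(u)^-1 (z - F u): if
   |F'^-1| <= c on a ball and F' is Lipschitz there, a uniform small t makes the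
   residual decrease geometrically while the total displacement stays below
   c' |z - F x|, for any c' > c.  In the ball B(u0, R) this reaches every z with
   |z - F u0| < R / m(R), whence (i).  In (ii), lift the segment from F x to z
   in N small steps starting at x; linear growth of |F'^-1| and a discrete
   Gronwall inequality keep the lift in a ball that does not depend on N, so
   the lift reaches the fibre over z.  Its end point is a locally constant
   function of x and fixes the fibre, and H is connected: the fibre is a
   single point. *)
Require Import Defs.
From HB Require Import structures.
From mathcomp Require Import all_boot all_order all_algebra sesquilinear.
From mathcomp Require Import all_classical all_reals all_analysis.
From mathcomp Require Import ring lra.

Set Implicit Arguments.
Unset Strict Implicit.
Unset Printing Implicit Defensive.

Import Order.TTheory GRing.Theory Num.Theory.
Import numFieldNormedType.Exports.

Local Open Scope classical_set_scope.
Local Open Scope ring_scope.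

(** * Operator norm estimates and a derivative criterion *)

Lemma opnorm_bound (R : realType) (V W : normedModType R) (L : V -> W) (c : R)
    (x : V) :
  scalable L -> (opnorm L <= c%:E)%E -> `|L x| <= c * `|x|.
Proof.
move=> LZ Lc.
have L1 v : `|v| <= 1 -> `|L v| <= c.
  by move=> v1; rewrite -lee_fin; apply: le_trans Lc; apply: ereal_sup_ubound; exists v.
have [->|x0] := eqVneq x 0.
  by rewrite -(scale0r (0 : V)) LZ !scale0r !normr0 mulr0.
have nx : 0 < `|x| by rewrite normr_gt0.
have := L1 (`|x|^-1 *: x).
rewrite LZ !normrZ normfV normr_id mulVf ?gt_eqF// => /(_ (lexx _)).
by rewrite mulrC ler_pdivrMr.
Qed.

Lemma bilinear_for_scalable (R : realType) (U V W : lmodType R)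
    (B : U -> V -> W) :
  bilinear_for *:%R *:%R B ->
  (forall v, scalable (B^~ v)) /\ (forall u, scalable (B u)).
Proof.
move=> [Bl Br]; split=> v k u.
  have := Bl v 1 0 0; rewrite /= !scale1r addr0 => /eqP.
  rewrite -subr_eq subrr => /eqP B0.
  by have := Bl v k u 0; rewrite /= -B0 !addr0.
have := Br v 1 0 0; rewrite /= !scale1r addr0 => /eqP.
rewrite -subr_eq subrr => /eqP B0.
by have := Br v k u 0; rewrite /= -B0 !addr0.
Qed.

(** One variable at a time: [opnorm_bound] for [B^~ y] with constant c |y|, then for each [B u] with
    [u] in the unit ball. *)
Lemma biopnorm_bound (R : realType) (V W : normedModType R)
    (B : V -> V -> W) (c : R) (x y : V) :
  bilinear_for *:%R *:%R B -> (biopnorm B <= c%:E)%E ->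
  `|B x y| <= c * `|x| * `|y|.
Proof.
move=> /bilinear_for_scalable[BZl BZr] Bc.
rewrite mulrAC; apply: (opnorm_bound _ (BZl _)).
apply: ub_ereal_sup => _ [u /= u1 <-]; rewrite lee_fin.
apply: (opnorm_bound _ (BZr _)).
apply: ub_ereal_sup => _ [v /= v1 <-]; rewrite lee_fin.
by rewrite -lee_fin; apply: le_trans Bc; apply: ereal_sup_ubound; exists (u, v).
Qed.

(** The division-free form matches the little-o estimates of Fréchet derivatives along a line. *)
Lemma is_derive_near (R : realType) (f : R -> R) (t d : R) :
  (forall e : R, 0 < e -> \forall s \near (0 : R),
    `|f (t + s) - f t - s * d| <= e * `|s|) ->
  is_derive t 1 f d.
Proof.
move=> fd.
have fcvg : (fun s : R => s^-1 *: (f (s *: (1 : R) + t) - f t)) @ 0^' --> d.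
  apply/cvgrPdist_le => e e0.
  have := fd e e0; rewrite near_withinE; apply: filterS => s fs s0.
  rewrite -(ler_pM2l (x := `|s|)) ?normr_gt0// -normrM mulrC mulrBl.
  rewrite /= /GRing.scale/= mulr1 mulrAC mulVf// mul1r.
  by rewrite distrC (addrC s t) [`|s| * e]mulrC (mulrC d).
apply: DeriveDef; last exact/cvg_lim.
by apply/cvg_ex; exists d.
Qed.

(** * Cauchy-Schwarz and the Taylor estimate *)

Section Dot.
Context {R : realType} {H : normedModType R} {dot : {dot H for idfun}}.
Hypothesis norm_dot : forall u : H, `|u| ^+ 2 = dot u u.

Let dotBl (u v w : H) : dot (u - v) w = dot u w - dot v w.
Proof. by rewrite linearBl. Qed.

Let dotBr (u v w : H) : dot w (u - v) = dot w u - dot w v.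
Proof. by rewrite linearBr. Qed.

Let dotZl (k : R) (u w : H) : dot (k *: u) w = k * dot u w.
Proof. by rewrite linearZl_LR. Qed.

Let dotZr (k : R) (u w : H) : dot w (k *: u) = k * dot w u.
Proof. by rewrite linearZr_LR. Qed.

(** Cauchy-Schwarz: the squared norm of |w|^2 u - (u,w) w equals |w|^2 (|u|^2 |w|^2 - (u,w)^2). *)
Lemma dot_le_norm (u w : H) : `|dot u w| <= `|u| * `|w|.
Proof.
have [->|w0] := eqVneq w 0; first by rewrite linear0r !normr0 mulr0.
have nw : 0 < `|w| by rewrite normr_gt0.
have uw : dot w u = dot u w by rewrite [RHS]hermC expr0 mul1r.
have e : `| `|w| ^+ 2 *: u - dot u w *: w| ^+ 2
       = `|w| ^+ 2 * (`|u| ^+ 2 * `|w| ^+ 2 - dot u w ^+ 2).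
  by rewrite (norm_dot (_ - _)) !(dotBl, dotBr, dotZl, dotZr) uw -!norm_dot; ring.
have : 0 <= `|w| ^+ 2 * (`|u| ^+ 2 * `|w| ^+ 2 - dot u w ^+ 2).
  by rewrite -e exprn_ge0.
rewrite pmulr_rge0 ?exprn_gt0// subr_ge0 -exprMn -(real_normK (num_real (dot u w))).
by rewrite ler_pXn2r// nnegrE// mulr_ge0.
Qed.

(* Pairing with the remainder itself reduces the estimate to the real function
   [t |-> dot (F (x + t h)) w], to which the mean value theorem applies twice. *)
Lemma taylor1_bound (F : H -> H) (K : R) (x h : H) :
  twice_differentiable F ->
  (forall t : R, 0 <= t <= 1 -> (biopnorm (diff2 F (x + t *: h)%R) <= K%:E)%E) ->
  `|F (x + h) - F x - 'd F x h| <= K * `|h| ^+ 2.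
Proof.
move=> [dF d2F] FK.
set w := F (x + h) - F x - 'd F x h.
have scale_cvg0 : (fun s : R => s *: h) @ (0 : R) --> (0 : H).
  by rewrite -(scale0r h); apply: cvgZr_tmp; exact: cvg_id.
have d1 (t : R) : is_derive t 1 (fun s => dot (F (x + s *: h)) w)
                          (dot ('d F (x + t *: h) h) w).
  apply: is_derive_near => e e0.
  (* Adding 1 to each norm keeps the tolerance positive when [h] or [w] is zero. *)
  have e'0 : 0 < e / ((`|h| + 1) * (`|w| + 1)).
    by rewrite divr_gt0// mulr_gt0// ltr_wpDl.
  have /diff_locallyP[_ /eqaddoP/(_ _ e'0) dFt] := dF (x + t *: h).
  apply: (@filterS _ (nbhs (0 : R)) _ _ _ _ (scale_cvg0 _ dFt)) => s /= fs.
  have {}fs : `|F (s *: h + (x + t *: h))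
      - (F (x + t *: h) + s *: 'd F (x + t *: h) h)|
      <= e / ((`|h| + 1) * (`|w| + 1)) * `|s *: h|.
    by rewrite -linearZ.
  rewrite scalerDl addrA (addrC _ (s *: h)).
  set A := F _ in fs *; set B := F _ in fs *; set C := diff _ _ _ in fs *.
  have -> : dot A w - dot B w - s * dot C w = dot (A - (B + s *: C)) w.
    by rewrite opprD addrA !dotBl dotZl.
  apply: le_trans (dot_le_norm _ _) _.
  apply: le_trans (ler_wpM2r (normr_ge0 w) fs) _.
  rewrite normrZ mulrC; set E := (e / _).
  have -> : e * `|s| = E * ((`|h| + 1) * (`|w| + 1)) * `|s|.
    by rewrite /E divfK// gt_eqF// mulr_gt0// ltr_wpDl.
  have : 0 <= E by exact: ltW.
  have : 0 <= `|s| by [].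
  have : 0 <= `|h| by [].
  have : 0 <= `|w| by [].
  move: (`|w|) (`|h|) (`|s|) => p q r p0 q0 r0 E0.
  have -> : p * (E * (r * q)) = E * (q * p) * r by ring.
  apply: ler_wpM2r => //; apply: ler_wpM2l => //.
  by apply: ler_pM => //; rewrite lerDl.
have d2 (t : R) : is_derive t 1 (fun s => dot ('d F (x + s *: h) h) w)
                          (dot (diff2 F (x + t *: h) h h) w).
  have [/bilinear_for_scalable[BZl BZr] _ Be] : is_diff2 F (x + t *: h) (diff2 F (x + t *: h)).
    exact: (getPex (d2F (x + t *: h))).
  apply: is_derive_near => e e0.
  have e'0 : 0 < e / ((`|h| ^+ 2 + 1) * (`|w| + 1)).
    by rewrite divr_gt0// mulr_gt0// ltr_wpDl// exprn_ge0.
  apply: (@filterS _ (nbhs (0 : R)) _ _ _ _ (scale_cvg0 _ (Be _ e'0))).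
  move=> s /= fs.
  have := opnorm_bound h _ fs.
  rewrite BZl scalerDl addrA => {}fs.
  have {}fs := fs _.
  set A := diff _ _ _ in fs *; set B := diff _ _ _ in fs *.
  set C := diff2 _ _ _ _ in fs *.
  have -> : dot A w - dot B w - s * dot C w = dot (A - B - s *: C) w.
    by rewrite !dotBl dotZl.
  apply: le_trans (dot_le_norm _ _) _.
  apply: le_trans (ler_wpM2r (normr_ge0 w) (fs _)) _.
    move=> k v; rewrite !linearZ /=.
    by rewrite BZr !scalerDr !scalerN.
  rewrite normrZ; set E := (e / _).
  have -> : e * `|s| = E * ((`|h| ^+ 2 + 1) * (`|w| + 1)) * `|s|.
    by rewrite /E divfK// gt_eqF// mulr_gt0// ltr_wpDl// exprn_ge0.
  have -> : E * (`|s| * `|h|) * `|h| * `|w| = E * (`|h| ^+ 2 * `|w|) * `|s|.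
    by ring.
  apply: ler_wpM2r => //; apply: ler_wpM2l; first exact: ltW.
  by apply: ler_pM; rewrite ?exprn_ge0 ?lerDl.
have [c c01] := MVT_segment ler01 (fun t _ => d1 t)
  (derivable_within_continuous (fun t _ => @ex_derive _ _ _ _ _ _ _ (d1 t))).
rewrite scale1r scale0r addr0 subr0 mulr1 => phi1.
have /andP[c0 c1] : 0 <= c <= 1 by move: c01; rewrite in_itv.
have [c' c0c] := MVT_segment c0 (fun t _ => d2 t)
  (derivable_within_continuous (fun t _ => @ex_derive _ _ _ _ _ _ _ (d2 t))).
rewrite scale0r addr0 subr0 => phi2.
have c'01 : 0 <= c' <= 1.
  by move: c0c; rewrite in_itv /= => /andP[-> /le_trans]; exact.
have [Bb _ _] : is_diff2 F (x + c' *: h) (diff2 F (x + c' *: h)).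
  exact: (getPex (d2F (x + c' *: h))).
have Bh := biopnorm_bound h h Bb (FK _ c'01).
(* As [w] is the remainder itself, its pairing with [w] is |w|^2; one factor |w| then cancels, and
   [c <= 1] is dropped. *)
have ww : `|w| ^+ 2 = dot (diff2 F (x + c' *: h) h h) w * c.
  by rewrite norm_dot {1}/w !dotBl phi1 phi2.
have [->|w0] := eqVneq w 0.
  by rewrite normr0; apply: le_trans (normr_ge0 _) _; rewrite expr2 mulrA; exact: Bh.
have nw : 0 < `|w| by rewrite normr_gt0.
rewrite -(ler_pM2r nw) -expr2 ww.
apply: le_trans (ler_norm _) _; rewrite normrM (ger0_norm c0).
apply: le_trans (ler_piMr _ c1) _ => //.
apply: le_trans (dot_le_norm _ _) _.
by rewrite ler_wpM2r// expr2 mulrA.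
Qed.

End Dot.

(** * Convergence of the damped Newton iteration *)

Section DampedNewton.
Context {R : realType} {V : completeNormedModType R}.

(* Damped Newton iteration [u |-> u + t G(u)(z - F u)].  Each step is at most
   [c'] times the decrease of the residual, so the total displacement
   telescopes and the orbit never leaves the ball. *)
Lemma damped_newton (F : V -> V) (L G : V -> V -> V) (x z : V) (r c c' K : R) :
  0 < c -> c < c' -> 0 <= K -> c' * `|z - F x| <= r ->
  continuous F -> (forall u, scalable (L u)) ->
  (forall u v, `|u - x| <= r -> `|v - x| <= r ->
    `|F v - F u - L u (v - u)| <= K * `|v - u| ^+ 2) ->
  (forall u k, `|u - x| <= r -> L u (G u k) = k) ->
  (forall u k, `|u - x| <= r -> `|G u k| <= c * `|k|) ->
  exists2 u, F u = z & `|u - x| <= c' * `|z - F x|.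
Proof.
move=> c0 cc' K0 xr Fcont LZ FL LG Gc.
have c'0 : 0 < c' by exact: lt_trans cc'.
pose D := `|z - F x|.
pose s := c / c'.
have s0 : 0 < s by rewrite divr_gt0.
have s1 : s < 1 by rewrite ltr_pdivrMr// mul1r.
have D0 : 0 <= D by exact: normr_ge0.
(* For d <= D this [t] makes the quadratic error K (t c d)^2 at most (1 - s) t d, so the residual
   shrinks by the factor 1 - t + (1 - s) t = 1 - t s. *)
pose t := (1 - s) / (K * c ^+ 2 * D + 1).
have den1 : 1 <= K * c ^+ 2 * D + 1.
  by rewrite lerDr !mulr_ge0// ltW.
have den0 : 0 < K * c ^+ 2 * D + 1 by exact: lt_le_trans den1.
have t0 : 0 < t by rewrite divr_gt0// subr_gt0.
have t1 : t <= 1.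
  rewrite ler_pdivrMr// mul1r; apply: le_trans den1.
  by rewrite gerBl ltW.
have tK : K * c ^+ 2 * D * t <= 1 - s.
  rewrite /t mulrA ler_pdivrMr// mulrC ler_wpM2l ?lerDl//.
  by rewrite subr_ge0 ltW.
pose step u := u + t *: G u (z - F u).
pose X n := iter n step x.
pose q := 1 - t * s.
have q0 : 0 <= q by rewrite subr_ge0 mulr_ile1// ltW.
have q1 : q < 1 by rewrite ltrBlDr ltrDl mulr_gt0.
(* The premise is the invariant of the orbit; it implies both d <= D and membership in the ball. *)
have stepP u : `|u - x| <= c' * (D - `|z - F u|) ->
    [/\ `|step u - u| <= c' * (`|z - F u| - `|z - F (step u)|) &
        `|z - F (step u)| <= q * `|z - F u|].
  move=> ux; set d := `|z - F u| in ux *.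
  have d0 : 0 <= d by exact: normr_ge0.
  have dD : d <= D.
    by rewrite -subr_ge0 -(pmulr_rge0 _ c'0); apply: le_trans ux.
  have ur : `|u - x| <= r.
    by apply: le_trans ux _; apply: le_trans xr; rewrite ler_pM2l// gerBl.
  have su : `|step u - u| <= t * (c * d).
    by rewrite /step addrC addKr normrZ gtr0_norm// ler_pM2l// Gc.
  have tcd : t * (c * d) <= c' * d.
    apply: le_trans (ler_piMl _ t1) _; first by rewrite mulr_ge0// ltW.
    by rewrite ler_wpM2r// ltW.
  (* The Taylor bound needs the new point in the ball before any decrease is known; c' (D - d) + c'
     d = c' D suffices. *)
  have sur : `|step u - x| <= r.
    apply: le_trans (ler_distD u _ _) _; apply: le_trans (lerD su ux) _.
    apply: le_trans (lerD tcd (lexx _)) _.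
    by rewrite mulrBr addrC subrK.
  have res : `|z - F (step u)| <= q * d.
    (* Since L u (step u - u) = t (z - F u), only the Taylor remainder is added to the damped
       residual. *)
    have -> : z - F (step u) = (1 - t) *: (z - F u)
        - (F (step u) - F u - L u (step u - u)).
      rewrite {3}/step (addrC u) addrK LZ LG// scalerBl scale1r.
      by rewrite opprB addrA subrK opprB addrA subrK.
    apply: le_trans (ler_normB _ _) _; rewrite normrZ ger0_norm ?subr_ge0//.
    apply: le_trans (lerD (lexx _) (FL _ _ ur sur)) _.
    apply: (@le_trans _ _ ((1 - t) * d + K * (t * (c * d)) ^+ 2)).
      rewrite lerD2l ler_wpM2l// ler_pXn2r ?nnegrE//.
      by apply: mulr_ge0; [exact: ltW | apply: mulr_ge0 => //; exact: ltW].
    have -> : K * (t * (c * d)) ^+ 2 = K * c ^+ 2 * d * t * (t * d) by ring.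
    have -> : q * d = (1 - t) * d + (1 - s) * (t * d) by rewrite /q; ring.
    rewrite lerD2l; apply: ler_wpM2r; first by rewrite mulr_ge0// ltW.
    apply: le_trans tK; apply: ler_wpM2r; first exact: ltW.
    by apply: ler_wpM2l => //; rewrite !mulr_ge0// ltW.
  split=> //; apply: le_trans su _.
  (* As c = c' s, the step bound is exactly c' times the guaranteed decrease. *)
  have -> : t * (c * d) = c' * (d - q * d).
    rewrite /q (_ : d - _ = t * s * d); last by ring.
    by rewrite /s; field; rewrite gt_eqF.
  by rewrite ler_pM2l// lerB.
have XP n : `|X n - x| <= c' * (D - `|z - F (X n)|) /\ `|z - F (X n)| <= geometric D q n.
  elim: n => [|n [Xn rn]]; first by rewrite /X /= !subrr normr0 mulr0 expr0 mulr1.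
  have [d1 d2] := stepP _ Xn; split; last first.
    by apply: le_trans d2 _; rewrite /= exprS mulrCA ler_wpM2l.
  apply: le_trans (ler_distD (X n) _ _) _.
  apply: le_trans (lerD d1 Xn) _.
  by rewrite -mulrDr addrC addrA subrK.
(* Telescoping from index [n] bounds all later displacement by c' times the residual at [n], whence
   the Cauchy property. *)
have XX n k : `|X (n + k)%N - X n| <= c' * (`|z - F (X n)| - `|z - F (X (n + k)%N)|).
  elim: k => [|k IH]; first by rewrite addn0 !subrr normr0 mulr0.
  rewrite addnS; have [d1 _] := stepP _ (XP (n + k)%N).1.
  apply: le_trans (ler_distD (X (n + k)%N) _ _) _; apply: le_trans (lerD d1 IH) _.
  by rewrite -mulrDr addrC addrA subrK.
have qn0 : geometric D q @ \oo --> 0.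
  by apply: cvg_geometric; rewrite ger0_norm.
have Xcvg : cvg (X @ \oo).
  apply: cauchy_cvg; apply: cauchy_exP => e e0.
  have [N _ qN] := cvgr0_norm_lt _ qn0 _ (divr_gt0 e0 c'0).
  exists (X N), N => //= n /subnKC <-.
  rewrite -ball_normE /= distrC; apply: le_lt_trans (XX _ _) _.
  have := qN N (leqnn N); rewrite /= ltr_pdivlMr// mulrC; apply: le_lt_trans.
  rewrite ler_pM2l//; apply: le_trans (ler_norm _); apply: le_trans (XP N).2.
  by rewrite gerBl.
set u := lim (X @ \oo).
have Xu : X @ \oo --> u by exact: Xcvg.
have FXu : (fun n => z - F (X n)) @ \oo --> z - F u.
  by apply: cvgB; [exact: cvg_cst | exact: (continuous_cvg _ (Fcont u) Xu)].
have FXz : (fun n => z - F (X n)) @ \oo --> 0.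
  apply/norm_cvg0P; apply: (squeeze_cvgr (f := fun=> 0) (h := geometric D q)) => //.
    by near=> n; rewrite normr_ge0 (XP n).2.
  exact: cvg_cst.
have Fu : F u = z.
  by apply/esym/eqP; rewrite -subr_eq0; apply/eqP; exact: (cvg_unique _ FXu FXz).
exists u => //.
have Xux : (fun n => `|X n - x|) @ \oo --> `|u - x|.
  by apply: cvg_norm; apply: cvgB => //; exact: cvg_cst.
rewrite -(cvg_lim _ Xux)//; apply: limr_le; first exact: (cvgP _ Xux).
near=> n; apply: le_trans (XP n).1 _.
by rewrite ler_pM2l// gerBl.
Unshelve. all: by end_near. Qed.

End DampedNewton.

(** * Lifting segments when the inverse derivative grows linearly *)

Section LinearGrowth.
Context {R : realType} {V : completeNormedModType R}.
Context {F : V -> V} {L G : V -> V -> V} {a b : R}.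
Hypotheses (a0 : 0 < a) (b0 : 0 < b) (F_cont : continuous F).
Hypothesis LZ : forall u, scalable (L u).
Hypothesis LG : forall u, cancel (G u) (L u).
Hypothesis GL : forall u, cancel (L u) (G u).
Hypothesis G_growth : forall u k, `|G u k| <= (a * `|u| + b) * `|k|.
Hypothesis L_bounded : forall r : R, exists2 M, 0 <= M &
  forall u k, `|u| <= r -> `|L u k| <= M * `|k|.
Hypothesis F_taylor : forall r : R, exists2 K, 0 <= K &
  forall u v, `|u| <= r -> `|v| <= r ->
    `|F v - F u - L u (v - u)| <= K * `|v - u| ^+ 2.

(* Twice the bound of [G] on the unit ball around a point of norm [r]; the
   factor 2 is the room [damped_newton] needs. *)
Definition gain (r : R) : R := 2 * (a * (r + 1) + b).

Lemma gain_gt0 r : 0 <= r -> 0 < gain r.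
Proof. by move=> r0; rewrite /gain mulr_gt0// addr_gt0// mulr_gt0// ltr_wpDl. Qed.

Lemma ler_gain r s : r <= s -> gain r <= gain s.
Proof. by move=> rs; rewrite /gain ler_pM2l// lerD2r ler_pM2l// lerD2r. Qed.

Lemma local_solve u z : gain `|u| * `|z - F u| <= 1 ->
  exists2 v, F v = z & `|v - u| <= gain `|u| * `|z - F u|.
Proof.
move=> uz; have [K K0 FK] := F_taylor (`|u| + 1).
have in_ball v : `|v - u| <= 1 -> `|v| <= `|u| + 1.
  move=> v1; rewrite -(subrK u v) addrC.
  by apply: le_trans (ler_normD _ _) _; rewrite lerD2l.
have c0 : 0 < a * (`|u| + 1) + b by rewrite addr_gt0// mulr_gt0// ltr_wpDl.
apply: (@damped_newton _ _ F L G u z 1 (a * (`|u| + 1) + b) (gain `|u|) K) => //.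
- by rewrite /gain ltr_pMl// ltr1n.
- by move=> v w /in_ball vu /in_ball wu; exact: FK.
- by move=> v k _; exact: LG.
- move=> v k /in_ball vu; apply: le_trans (G_growth _ _) _.
  by rewrite ler_wpM2r// lerD2r ler_pM2l.
Qed.

Lemma locally_lipschitz (r : R) : exists2 M, 0 <= M &
  forall u v, `|u| <= r -> `|v| <= r -> `|F u - F v| <= M * `|u - v|.
Proof.
have [r0|r0] := ltP r 0.
  by exists 0 => // u v /le_lt_trans/(_ r0); rewrite normr_lt0.
have [K K0 FK] := F_taylor r; have [M M0 LM] := L_bounded r.
exists (M + K * (r + r)) => [|u v ur vr].
  by rewrite addr_ge0// mulr_ge0// addr_ge0.
rewrite -(subrK (L v (u - v)) (F u - F v)) mulrDl addrC.
apply: le_trans (ler_normD _ _) _; apply: lerD; first exact: LM.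
apply: le_trans (FK _ _ vr ur) _.
rewrite expr2 mulrA ler_wpM2r// ler_wpM2l//.
by apply: le_trans (ler_normB _ _) _; exact: lerD.
Qed.

(** Write u - v = G v (L v (u - v)); replacing L v (u - v) by F u - F v costs a quadratic error,
    absorbed in the left side at short distance. *)
Lemma locally_expanding (r : R) : 0 <= r -> exists d l : R,
  [/\ 0 < d, 0 < l & forall u v, `|u| <= r -> `|v| <= r ->
    `|u - v| <= d -> `|u - v| <= l * `|F u - F v|].
Proof.
move=> r0; have [K K0 FK] := F_taylor r.
pose c := a * r + b.
have c0 : 0 < c by rewrite /c ltr_wpDl// mulr_ge0// ltW.
have den0 : 0 < 2 * (c * (K + 1)).
  by rewrite !mulr_gt0// ltr_pwDr.
(* The radius makes c K |u - v| at most 1/2; [K + 1] covers K = 0. *)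
exists (2 * (c * (K + 1)))^-1, (2 * c); split; [by rewrite invr_gt0 | by rewrite mulr_gt0 |].
move=> u v ur vr uvd.
have uv : `|u - v| <= c * (`|F u - F v| + K * `|u - v| ^+ 2).
  rewrite -{1}(GL v (u - v)); apply: le_trans (G_growth _ _) _.
  apply: ler_pM => //; first by rewrite addr_ge0 ?mulr_ge0// ltW.
    by rewrite lerD2r ler_pM2l.
  rewrite -[L v _](subKr (F u - F v)); apply: le_trans (ler_normB _ _) _.
  by rewrite lerD2l FK.
have {}uvd : c * (K * `|u - v| ^+ 2) <= 2^-1 * `|u - v|.
  have -> : c * (K * `|u - v| ^+ 2) = c * K * `|u - v| * `|u - v| by ring.
  rewrite ler_wpM2r//.
  apply: (@le_trans _ _ (c * (K + 1) * (2 * (c * (K + 1)))^-1)).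
    apply: ler_pM => //; first by rewrite mulr_ge0// ltW.
    by rewrite ler_pM2l// lerDl.
  by rewrite invfM mulrCA mulfV ?mulr1// gt_eqF// mulr_gt0// ltr_wpDl.
by move: uv uvd; rewrite mulrDr -[2 * c * _]mulrA; lra.
Qed.

(** The default [u] is returned only if no such [v] exists, which [lift_stepP] excludes for small
    [w]. *)
Definition lift_step (w u : V) : V :=
  xget u [set v | F v = F u + w /\ `|v - u| <= gain `|u| * `|w|].

Lemma lift_stepP w u : gain `|u| * `|w| <= 1 ->
  F (lift_step w u) = F u + w /\
  `|lift_step w u - u| <= gain `|u| * `|w|.
Proof.
move=> uw; apply: (@xgetPex _ u [set v | F v = F u + w /\ `|v - u| <= gain `|u| * `|w|]).
have := @local_solve u (F u + w); rewrite addrC addKr => /(_ uw)[v Fv vu].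
by exists v; split=> //; rewrite addrC.
Qed.

(* Discrete Gronwall estimate: [|u| + 1 + b / a] grows by a factor of at most
   [1 + 2 a |w| <= expR (2 a |w|)] per step. *)
Lemma lift_bound (N : nat) (w x : V) (r : R) :
  expR (2 * a * (N%:R * `|w|)) * (`|x| + 1 + b / a) <= r ->
  gain r * `|w| <= 1 ->
  forall k, (k <= N)%N ->
    F (iter k (lift_step w) x) = F x + k%:R *: w /\
    `|iter k (lift_step w) x| <= r.
Proof.
move=> xr rw; set A := fun u : V => `|u| + 1 + b / a.
have ba0 : 0 < b / a by rewrite divr_gt0.
have A_ge u : `|u| <= A u by rewrite /A -addrA lerDl addr_ge0// ltW.
have A0 u : 0 <= A u by exact: le_trans (A_ge u).
(* The shift by 1 + b / a turns the affine gain into a linear one, as the Gronwall recursion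
   requires. *)
have gainA u : gain `|u| = 2 * a * A u.
  by rewrite /gain /A; field; rewrite gt_eqF.
have growth k : (k <= N)%N -> expR (2 * a * `|w|) ^+ k * A x <= r.
  move=> kN; apply: le_trans xr; apply: ler_wpM2r; first exact: A0.
  rewrite -expRM_natl ler_expR.
  have -> : 2 * a * (N%:R * `|w|) = N%:R * (2 * a * `|w|) by ring.
  by rewrite ler_wpM2r ?ler_nat// mulr_ge0// mulr_ge0// ltW.
have main k : (k <= N)%N -> F (iter k (lift_step w) x) = F x + k%:R *: w /\
    A (iter k (lift_step w) x) <= expR (2 * a * `|w|) ^+ k * A x.
  elim: k => [_|k IH kN]; first by rewrite scale0r addr0 expr0 mul1r.
  have [Fk Ak] := IH (ltnW kN); rewrite iterS.
  set u := iter k _ x in Fk Ak *.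
  have ur : `|u| <= r.
    by apply: le_trans (A_ge u) _; apply: le_trans Ak _; exact/growth/ltnW.
  have uw : gain `|u| * `|w| <= 1.
    by apply: le_trans rw; rewrite ler_wpM2r// ler_gain.
  have [Fu ule] := lift_stepP uw; split.
    by rewrite Fu Fk -addrA -[in RHS]addn1 natrD scalerDl scale1r.
  apply: (@le_trans _ _ ((1 + 2 * a * `|w|) * A u)).
    rewrite mulrDl mul1r mulrAC -gainA {1}/A.
    have : `|lift_step w u| <= `|lift_step w u - u| + `|u|.
      by rewrite -{1}(subrK u (lift_step w u)) ler_normD.
    by move: ule; rewrite /A; lra.
  rewrite exprS -[leRHS]mulrA; apply: (ler_pM _ (A0 _) (expR_ge1Dx _) Ak).
  by rewrite addr_ge0// mulr_ge0// mulr_ge0// ltW.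
move=> k kN; have [-> Ak] := main k kN; split=> //.
by apply: le_trans (A_ge _) _; apply: le_trans Ak _; exact: growth.
Qed.

Definition lift_end (N : nat) (z x : V) : V :=
  iter N (lift_step (N%:R^-1 *: (z - F x))) x.

(** The increment is zero, and the displacement bound then forces every step to stay put. *)
Lemma lift_end_fiber N x : lift_end N (F x) x = x.
Proof.
rewrite /lift_end subrr scaler0; elim: N => // N IH; rewrite iterS IH.
have [|_] := @lift_stepP 0 x; first by rewrite normr0 mulr0.
by rewrite normr0 mulr0 normr_le0 subr_eq0 => /eqP.
Qed.

(* Two lifts that start close stay close: a step moves each of them by at most
   a third of the radius of injectivity, and in between [locally_expanding]
   bounds their distance by that of their images, which only decreases. *)
Lemma lift_end_locally_constant (z : V) (rho : R) : 0 <= rho ->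
  exists (N : nat) (d : R), [/\ 0 < d,
    forall x, `|x| <= rho -> F (lift_end N z x) = z &
    forall x y, `|x| <= rho -> `|y| <= rho -> `|x - y| <= d ->
      lift_end N z x = lift_end N z y].
Proof.
move=> rho0; have [M M0 FM] := locally_lipschitz rho.
pose D := `|z - F 0| + M * rho.
have D0 : 0 <= D by rewrite addr_ge0// mulr_ge0.
have FD x : `|x| <= rho -> `|z - F x| <= D.
  move=> xr; apply: le_trans (ler_distD (F 0) _ _) _; rewrite lerD2l.
  apply: le_trans (FM _ _ _ xr) _; first by rewrite normr0.
  by rewrite sub0r normrN ler_wpM2l.
(* The Gronwall radius for all starts in the ball; it is fixed before [N]. *)
pose r := expR (2 * a * D) * (rho + 1 + b / a).
have s0 : 0 < rho + 1 + b / a by rewrite addr_gt0 ?divr_gt0// ltr_wpDl.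
have r0 : 0 <= r by rewrite mulr_ge0 ?expR_ge0// ltW.
have [e [l [e0 l0 Fe]]] := locally_expanding r0.
(* The bound 1 makes each step solvable, e / 3 keeps it short. *)
pose eta := Num.min 1 (e / 3).
have eta0 : 0 < eta by rewrite lt_min ltr01 divr_gt0.
pose N := (Num.truncn (gain r * D / eta)).+1.
have N0 : 0 < N%:R :> R by rewrite ltr0n.
have ND : gain r * (D / N%:R) <= eta.
  rewrite mulrA ler_pdivrMr// [leRHS]mulrC -ler_pdivrMr//.
  exact/ltW/truncnS_gt.
pose w x := N%:R^-1 *: (z - F x).
have Nw x : N%:R * `|w x| = `|z - F x|.
  by rewrite normrZ ger0_norm ?invr_ge0// mulrA mulfV ?mul1r// gt_eqF.
have ww x : `|x| <= rho -> gain r * `|w x| <= eta.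
  move=> xr; apply: le_trans ND; rewrite ler_pM2l ?gain_gt0//.
  by rewrite ler_pdivlMr// mulrC Nw FD.
have lift x : `|x| <= rho -> forall k, (k <= N)%N ->
    F (iter k (lift_step (w x)) x) = F x + k%:R *: w x /\
    `|iter k (lift_step (w x)) x| <= r.
  move=> xr; apply: lift_bound.
    rewrite Nw; apply: ler_pM; first exact: expR_ge0.
    - by rewrite addr_ge0 ?addr_ge0// ltW// divr_gt0.
    - by rewrite ler_expR ler_pM2l ?mulr_gt0// FD.
    - by rewrite !lerD2r.
  by apply: le_trans (ww _ xr) _; rewrite ge_min lexx.
(* The bound [e] starts the induction at k = 0; the other gives l M |x - y| <= e / 3. *)
exists N, (Num.min e (e / 3 / (l * (M + 1)))); split.
- by rewrite lt_min e0 !divr_gt0// mulr_gt0// ltr_wpDl.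
- move=> x xr; have [-> _] := lift x xr N (leqnn N).
  by rewrite scalerA mulfV ?gt_eqF// scale1r addrC subrK.
move=> x y xr yr; rewrite le_min => /andP[xye xyd].
pose X k := iter k (lift_step (w x)) x.
pose Y k := iter k (lift_step (w y)) y.
(* Both lifts aim at [z], so their images approach linearly and coincide at k = N. *)
have FXY k : (k <= N)%N -> F (X k) - F (Y k) = (1 - k%:R / N%:R) *: (F x - F y).
  move=> kN; have [-> _] := lift x xr k kN; have [-> _] := lift y yr k kN.
  have wB : w x - w y = - (N%:R^-1 *: (F x - F y)).
    rewrite /w -scalerBr -scalerN !opprB; congr (_ *: _).
    by rewrite addrC addrA subrK.
  rewrite opprD addrACA -scalerBr wB scalerN scalerA.
  by rewrite -{1}[F x - F y]scale1r -scalerBl.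
have close k : (k <= N)%N -> `|X k - Y k| <= l * `|F (X k) - F (Y k)|.
  elim: k => [_|k IH kN]; first exact: Fe (lift x xr 0%N isT).2 (lift y yr 0%N isT).2 xye.
  have kN' := ltnW kN.
  have Xr := (lift x xr k kN').2; have Yr := (lift y yr k kN').2.
  have step u v : `|v| <= rho -> `|u| <= r -> `|lift_step (w v) u - u| <= e / 3.
    move=> vr ur; have guw : gain `|u| * `|w v| <= eta.
      by apply: le_trans (ww _ vr); rewrite ler_wpM2r// ler_gain.
    have [|_ h] := @lift_stepP (w v) u.
      by apply: le_trans guw _; rewrite ge_min lexx.
    by apply: le_trans h _; apply: le_trans guw _; rewrite ge_min lexx orbT.
  have XY : `|X k - Y k| <= e / 3.
    apply: le_trans (IH kN') _; rewrite mulrC -ler_pdivlMr// FXY//.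
    rewrite normrZ ger0_norm; last first.
      by rewrite subr_ge0 ler_pdivrMr// mul1r ler_nat.
    apply: (@le_trans _ _ `|F x - F y|).
      by rewrite ler_piMl// gerBl divr_ge0.
    apply: le_trans (FM _ _ xr yr) _.
    move: xyd; rewrite invfM mulrA ler_pdivlMr ?ltr_wpDl// mulrC.
    by apply: le_trans; rewrite ler_wpM2r// lerDl.
  apply: Fe; [exact: (lift x xr k.+1 kN).2 | exact: (lift y yr k.+1 kN).2|].
  have hX := step _ _ xr Xr; have hY := step _ _ yr Yr.
  rewrite -[X k.+1]/(lift_step (w x) (X k)) -[Y k.+1]/(lift_step (w y) (Y k)).
  apply: le_trans (ler_distD (X k) _ _) _.
  apply: le_trans (lerD hX (ler_distD (Y k) _ _)) _.
  apply: le_trans (lerD (lexx _) (lerD XY _)) _; first by rewrite distrC; exact: hY.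
  by lra.
have := close N (leqnn N); rewrite FXY// mulfV ?gt_eqF// subrr scale0r normr0 mulr0.
by rewrite normr_le0 subr_eq0 => /eqP.
Qed.

(** The segment from [u] to [v] stays in the ball of radius |u| + |v|; cut into pieces shorter than
    [d], it carries equal lift ends from [u] to [v], and both are fixed. *)
Lemma linear_growth_inj : injective F.
Proof.
move=> u v Fuv; pose rho := `|u| + `|v|.
have [//|N [d [d0 _ constN]]] := @lift_end_locally_constant (F u) rho.
  exact: addr_ge0.
pose n := (Num.truncn (`|v - u| / d)).+1.
have n0 : 0 < n%:R :> R by rewrite ltr0n.
pose p (i : nat) := u + (i%:R / n%:R) *: (v - u).
have pr i : (i <= n)%N -> `|p i| <= rho.
  move=> i_n; set t := i%:R / n%:R : R.
  have t0 : 0 <= t by rewrite divr_ge0.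
  have t1 : t <= 1 by rewrite ler_pdivrMr// mul1r ler_nat.
  have -> : p i = (1 - t) *: u + t *: v.
    by rewrite /p scalerBl scale1r scalerBr addrA addrAC.
  apply: le_trans (ler_normD _ _) _; rewrite !normrZ !ger0_norm ?subr_ge0//.
  by apply: lerD; rewrite ler_piMl// gerBl.
have pS i : `|p i.+1 - p i| <= d.
  rewrite /p opprD addrACA subrr add0r -scalerBl -mulrBl -natrB// subSnn.
  rewrite normrZ mul1r ger0_norm ?invr_ge0// mulrC ler_pdivrMr// [leRHS]mulrC.
  by rewrite -ler_pdivrMr//; exact/ltW/truncnS_gt.
have const i : (i <= n)%N -> lift_end N (F u) (p i) = lift_end N (F u) (p 0%N).
  elim: i => // i IH i_n; rewrite -(IH (ltnW i_n)).
  by apply: constN (pr _ i_n) (pr _ (ltnW i_n)) (pS i).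
have := const n (leqnn n).
rewrite /p mul0r scale0r addr0 mulfV ?gt_eqF// scale1r addrC subrK.
by rewrite lift_end_fiber {1}Fuv lift_end_fiber.
Qed.

Lemma linear_growth_homeomorphism : homeomorphism F.
Proof.
have surj z : exists x, F x = z.
  have [N [d [_ FN _]]] := lift_end_locally_constant z (lexx (0 : R)).
  by exists (lift_end N z 0); apply: FN; rewrite normr0.
have [g gK] := choice surj.
exists g; split=> //; last by move=> x; apply: linear_growth_inj; rewrite gK.
move=> z; apply/cvgrPdist_le => e e0.
have gz := gain_gt0 (normr_ge0 (g z)).
(* Within this distance [local_solve] finds a preimage of [y] within [e] of [g z]; injectivity
   identifies it with [g y]. *)
have d0 : 0 < Num.min 1 e / gain `|g z|.
  by rewrite divr_gt0// lt_min ltr01.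
apply: (@filterS _ (nbhs z) _ _ _ _ (@cvgr_dist_le _ V _ _ _ id z cvg_id _ d0)).
move=> y /=; rewrite distrC ler_pdivlMr// mulrC le_min => /andP[y1 ye].
have [|x Fx xz] := @local_solve (g z) y; first by rewrite gK.
have -> : g y = x by apply: linear_growth_inj; rewrite gK.
by rewrite distrC; apply: le_trans xz _; rewrite gK.
Qed.

End LinearGrowth.

(* A real Hilbert space is a complete normed module whose norm comes from an
   inner product [dot]. *)
Theorem theorem1p1 (R : realType) (H : completeNormedModType R)
    (dot : {dot H for idfun}) (norm_dot : forall u : H, `|u| ^+ 2 = dot u u)
    (u0 : H) (F : H -> H)
    (F_diff2 : twice_differentiable F)
    (F_inv : forall u : H, boundedly_invertible ('d F u))
    (M1 M2 m : R -> R)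
    (m_gt0 : forall r : R, 0 < r -> 0 < m r)
    (F_M1 : forall r : R, 0 < r ->
      (ereal_sup [set opnorm ('d F u) | u in [set u : H | (`|u - u0| <= r)%R]]
        <= (M1 r)%:E)%E)
    (F_M2 : forall r : R, 0 < r ->
      (ereal_sup [set biopnorm (diff2 F u) | u in [set u : H | (`|u - u0| <= r)%R]]
        <= (M2 r)%:E)%E)
    (F_m : forall r : R, 0 < r ->
      (ereal_sup [set opnorm (opinv ('d F u)) | u in [set u : H | (`|u - u0| <= r)%R]]
        <= (m r)%:E)%E) :
  (ereal_sup [set (r / m r)%:E | r in [set r : R | (0 < r)%R]] = +oo%E ->
    set_surj [set: H] [set: H] F)
  /\
  (forall a b : R, 0 < a -> 0 < b ->
    (forall u : H, (opnorm (opinv ('d F u)) <= (a * `|u| + b)%:E)%E) ->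
    homeomorphism F).
Proof.
have [F_diff _] := F_diff2.
have LZ u : scalable ('d F u) by move=> k x; rewrite linearZ.
have /all_and3 [_ GL LG] u : is_bounded_inverse ('d F u) (opinv ('d F u)).
  exact: getPex (F_inv u).
have GZ u : scalable (opinv ('d F u)) by move=> k x; rewrite linearZ.
have F_cont : continuous F by move=> u; exact: differentiable_continuous.
have F_taylor r : 0 < r -> forall u v, `|u - u0| <= r -> `|v - u0| <= r ->
    `|F v - F u - 'd F u (v - u)| <= `|M2 r| * `|v - u| ^+ 2.
  move=> r0 u v ur vr.
  rewrite -{1}(subrK u v) [v - u + u]addrC; apply: taylor1_bound norm_dot _ _ _ _ F_diff2 _.
  move=> t /andP[t0 t1]; apply: (@le_trans _ _ (M2 r)%:E); last first.
    by rewrite lee_fin ler_norm.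
  apply: le_trans (F_M2 _ r0); apply: ereal_sup_ubound.
  exists (u + t *: (v - u)) => //=.
  have -> : u + t *: (v - u) - u0 = (1 - t) *: (u - u0) + t *: (v - u0).
    rewrite scalerBl scale1r -[RHS]addrA [- _ + _]addrC -scalerBr.
    by rewrite opprB addrA subrK addrAC.
  apply: le_trans (ler_normD _ _) _; rewrite !normrZ !ger0_norm ?subr_ge0//.
  have -> : r = (1 - t) * r + t * r by ring.
  by apply: lerD; rewrite ler_wpM2l ?subr_ge0.
split=> [m_sup | a b a0 b0 Gab].
  move=> y _; pose D := `|y - F u0|.
  (* The extra 1 leaves room for c' = r / (D + 1), strictly above [m r] and with c' D <= r. *)
  have [r r0 Dm] : exists2 r, 0 < r & D + 1 < r / m r.
    apply: contrapT => nr.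
    have : (ereal_sup [set (r / m r)%:E | r in [set r : R | (0 < r)%R]]
              <= (D + 1)%:E)%E.
      apply: ub_ereal_sup => _ [r /= r0 <-]; rewrite lee_fin leNgt.
      by apply/negP => Dr; apply: nr; exists r.
    by rewrite m_sup.
  have D0 : 0 <= D by exact: normr_ge0.
  have D1 : 0 < D + 1 by rewrite ltr_wpDl.
  have [u Fu _] : exists2 u, F u = y & `|u - u0| <= r / (D + 1) * `|y - F u0|.
    apply: (@damped_newton _ _ F (fun u => 'd F u) (fun u => opinv ('d F u))
      u0 y r (m r) (r / (D + 1)) `|M2 r|) => //.
    - exact: m_gt0.
    - by rewrite ltr_pdivlMr// mulrC -ltr_pdivlMr// m_gt0.
    - by rewrite -/D mulrAC ler_pdivrMr// ler_pM2l// lerDl.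
    - exact: F_taylor.
    - by move=> u k _; exact: LG.
    - move=> u k ur; apply: opnorm_bound (GZ _) _.
      by apply: le_trans (F_m _ r0); apply: ereal_sup_ubound; exists u.
  by exists u.
(* Passes from balls about 0 to balls about [u0]; the added 1 makes the radius positive. *)
have ballP r u : `|u| <= r -> 0 < `|u0| + r + 1 /\ `|u - u0| <= `|u0| + r + 1.
  move=> ur; have r0 : 0 <= r by exact: le_trans ur.
  split; first by rewrite ltr_wpDl// addr_ge0.
  apply: le_trans (ler_normB _ _) _; rewrite addrC -addrA lerD2l.
  by apply: le_trans ur _; rewrite lerDl.
apply: (@linear_growth_homeomorphism _ _ F (fun u => 'd F u)
  (fun u => opinv ('d F u)) a b) => //.
- by move=> u k; apply: opnorm_bound (GZ _) (Gab u).
- move=> r; exists `|M1 (`|u0| + r + 1)| => // u k /ballP[r0 ur].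
  apply: opnorm_bound (LZ _) _; apply: (@le_trans _ _ (M1 (`|u0| + r + 1))%:E).
    by apply: le_trans (F_M1 _ r0); apply: ereal_sup_ubound; exists u.
  by rewrite lee_fin ler_norm.
- move=> r; exists `|M2 (`|u0| + r + 1)| => // u v /ballP[r0 ur] /ballP[_ vr].
  exact: F_taylor.
Qed.
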